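(* Let $\alpha\in(1/3,1)$, let $x:[0,1]\to\mathbb{R}$ be a function in $\mathrm{C}^\alpha$, let $h:\mathbb{R}^2\to\mathbb{R}$ be a $\mathscr{C}^{2,1}$ function, let $\ell:[0,1]\to\mathbb{R}$ be a function of bounded variation, and define $y_t=h(x_t,\ell_t)$ for $t\in[0,1]$. For $r,s\in[0,1]$ set $$A_{rs}=\int_r^s y\,\mathrm{d}^\circ x-\frac{y_r+y_s}{2}(x_s-x_r).$$ Then for any function $f:\mathbb{R}\to\mathbb{R}$ of class $\mathscr{C}^2$ and all $0\le a\le b\le 1$, $$\int_a^b f(y_s)\,\mathrm{d}^{A,1}x_s=\int_a^b f(y_s)\,\mathrm{d}^\circ x_s .$$
   Context: $\mathrm{C}^\alpha$ is the set of functions $z:[0,1]\to\mathbb{R}$ for which there is $L>0$ with $|z_t-z_s|\le L|t-s|^\alpha$ for all $s,t\in[0,1]$. A $\mathscr{C}^{2,1}$ function on $\mathbb{R}^2$ is one that is $\mathscr{C}^2$ in the first variable and $\mathscr{C}^1$ in the second. Russo–Vallois symmetric integral (whenever the limit exists): $$\int_r^s z_u\,\mathrm{d}^\circ x_u=\lim_{\varepsilon\downarrow0}\varepsilon^{-1}\int_r^s\frac{z_{u+\varepsilon}+z_u}{2}(x_{u+\varepsilon}-x_u)\,\mathrm{d}u,$$ with $\int_r^s=-\int_s^r$ if $r>s$. Corrected symmetric integral: $$\int_a^b f(y_s)\,\mathrm{d}^{A,1}x_s=\lim_{\varepsilon\downarrow0}\left(\varepsilon^{-1}\int_a^b\frac{f(y_s)+f(y_{s+\varepsilon})}{2}(x_{s+\varepsilon}-x_s)\,\mathrm{d}s+\varepsilon^{-1}\int_a^b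 f'(y_s)A_{s,s+\varepsilon}\,\mathrm{d}s\right).$$ Convention: for times beyond $1$, $x_t=x_1$, $\ell_t=\ell_1$, $y_t=y_1$ for $t>1$, and $A_{st}=A_{s\wedge1,\,t\wedge1}$. *)

(* Defs.v *)
From HB Require Import structures.
From mathcomp Require Import all_boot all_order all_algebra.
From mathcomp Require Import all_classical all_reals all_analysis.

Set Implicit Arguments.
Unset Strict Implicit.
Unset Printing Implicit Defensive.

Import Order.TTheory GRing.Theory Num.Theory.
Import numFieldNormedType.Exports.

Local Open Scope classical_set_scope.
Local Open Scope ring_scope.

(* A function on [0, 1] is represented by a total function R -> R whose values
   outside [0, 1] are never used. *)

Definition holder01 (R : realType) (alpha : R) (z : R -> R) : Prop :=
  exists2 L : R, 0 < L &
    forall s t : R, 0 <= s <= 1 -> 0 <= t <= 1 ->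
      `|z t - z s| <= L * `|t - s| `^ alpha.

Definition class_C2 (R : realType) (f : R -> R) : Prop :=
  [/\ forall t, derivable f t 1,
      forall t, derivable (derive1 f) t 1 &
      continuous (derive1n 2 f)].

Definition partial1 (R : realType) (h : R * R -> R) (p : R * R) : R :=
  derive1 (fun u => h (u, p.2)) p.1.

Definition partial2 (R : realType) (h : R * R -> R) (p : R * R) : R :=
  derive1 (fun v => h (p.1, v)) p.2.

(* As usual, the partial derivatives are required to be continuous jointly in
   the two variables. *)
Definition class_C21 (R : realType) (h : R * R -> R) : Prop :=
  [/\ forall p : R * R, derivable (fun u => h (u, p.2)) p.1 1,
      forall p : R * R, derivable (fun u => partial1 h (u, p.2)) p.1 1 &
      forall p : R * R, derivable (fun v => h (p.1, v)) p.2 1] /\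
  [/\ continuous h,
      continuous (partial1 h),
      continuous (partial1 (partial1 h)) &
      continuous (partial2 h)].

(* z_t = z_1 for t > 1. *)
Definition stopped1 (R : realType) (z : R -> R) (t : R) : R :=
  z (Num.min t 1).

Definition sym_integrand (R : realType) (z x : R -> R) (e u : R) : R :=
  (stopped1 z (u + e) + stopped1 z u) / 2
  * (stopped1 x (u + e) - stopped1 x u).

Definition sym_approx (R : realType) (z x : R -> R) (r s e : R) : R :=
  e^-1 * \int[lebesgue_measure]_(u in `[r, s]) sym_integrand z x e u.

(* Existence of the symmetric integral from r to s, for r <= s; for r > s it is
   the existence of the one from s to r.  Integrability is part of it because
   Rintegral and lim are total and return junk values. *)
Definition sym_exists (R : realType) (z x : R -> R) (r s : R) : Prop :=
  (\forall e \near 0^'+,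
     lebesgue_measure.-integrable `[r, s] (EFin \o sym_integrand z x e)) /\
  cvg (sym_approx z x r s e @[e --> 0^'+]).

Definition sym_integral (R : realType) (z x : R -> R) (r s : R) : R :=
  if r <= s then lim (sym_approx z x r s e @[e --> 0^'+])
  else - lim (sym_approx z x s r e @[e --> 0^'+]).

(* A_{rs} *)
Definition levy_area (R : realType) (y x : R -> R) (r s : R) : R :=
  sym_integral y x r s - (y r + y s) / 2 * (x s - x r).

Definition corr_integrand (R : realType) (f y : R -> R) (A : R -> R -> R)
    (e s : R) : R :=
  derive1 f (stopped1 y s) * A (Num.min s 1) (Num.min (s + e) 1).

Definition corr_approx (R : realType) (f y x : R -> R) (A : R -> R -> R)
    (a b e : R) : R :=
  sym_approx (f \o y) x a b e
  + e^-1 * \int[lebesgue_measure]_(s in `[a, b]) corr_integrand f y A e s.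

Definition corr_exists (R : realType) (f y x : R -> R) (A : R -> R -> R)
    (a b : R) : Prop :=
  (\forall e \near 0^'+,
     lebesgue_measure.-integrable `[a, b]
       (EFin \o sym_integrand (f \o y) x e) /\
     lebesgue_measure.-integrable `[a, b] (EFin \o corr_integrand f y A e)) /\
  cvg (corr_approx f y x A a b e @[e --> 0^'+]).

(* The integral of f(y) d^{A,1}x over [a, b], for a <= b. *)
Definition corr_integral (R : realType) (f y x : R -> R) (A : R -> R -> R)
    (a b : R) : R :=
  lim (corr_approx f y x A a b e @[e --> 0^'+]).

(* Main.v *)
(* Let H(., w) be an antiderivative of h(., w).  Fix s and put
   D(u) = H(x_u, l_u) - H(x_s, l_u).  The increment D(u + e) - D(u) equals
   (y_u + y_{u+e})/2 (x_{u+e} - x_u) up to the error of the trapezoid rule,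
   which is O(e^{3 alpha}), and up to rectangular increments of H, which are
   bounded by |l_{u+e} - l_u| times an increment of x.  Integrating over [s, t]
   and dividing by e, the increments of D telescope to a mean of D near t minus
   one near s.  With W the total variation function of l this gives
     | e^{-1} int_s^t (y_u + y_{u+e})/2 (x_{u+e} - x_u) du
       - (y_s + y_t)/2 (x_t - x_s) |
     <= C (|t - s|^{3 alpha} + (W(t + e) - W(s)) |t - s|^alpha) + o(1), e -> 0.
   Summing over a fine partition shows that the left-hand means are Cauchy, so
   the symmetric integral exists, for h as well as for f o h.  Letting e -> 0,
   |A_{st}| <= C (|t - s|^{3 alpha} + (W(t + d) - W(s)) |t - s|^alpha) for every
   d > 0; since int (W(s + 2e) - W(s)) ds = O(e), the correction term is
   O(e^{3 alpha - 1} + e^alpha). *)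
Require Import Defs.
From HB Require Import structures.
From mathcomp Require Import all_boot all_order all_algebra.
From mathcomp Require Import all_classical all_reals all_analysis.
From mathcomp Require Import measurable_realfun.
From mathcomp Require Import ring lra.

Import Order.TTheory GRing.Theory Num.Theory.
Import numFieldNormedType.Exports.

Local Open Scope classical_set_scope.
Local Open Scope ring_scope.

(** * Integrals of bounded measurable functions over intervals *)

Section BoundedMeasurable.
Context {R : realType}.
Local Notation mu := (@lebesgue_measure R).
Implicit Types (f g : R -> R) (a b c d e : R).

(** Both conditions are imposed on the whole line, so that the class is stable under the shifts
    [u + e] and yields integrability over every compact interval. *)
Definition bounded_measurable f : Prop :=
  measurable_fun [set: R] f /\ exists C : R, forall u, `|f u| <= C.

Lemma bounded_measurable_cst c : bounded_measurable (fun=> c).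
Proof. by split=> //; exists `|c|. Qed.

Lemma bounded_measurableD f g : bounded_measurable f -> bounded_measurable g ->
  bounded_measurable (fun u => f u + g u).
Proof.
move=> [mf [C Cf]] [mg [D Dg]]; split; first exact: measurable_funD.
by exists (C + D) => u; rewrite (le_trans (ler_normD _ _))// lerD.
Qed.

Lemma bounded_measurableN f : bounded_measurable f ->
  bounded_measurable (fun u => - f u).
Proof.
move=> [mf [C Cf]]; split; first exact: measurable_funN.
by exists C => u; rewrite normrN.
Qed.

Lemma bounded_measurableB f g : bounded_measurable f -> bounded_measurable g ->
  bounded_measurable (fun u => f u - g u).
Proof.
by move=> bf bg; apply: bounded_measurableD => //; exact: bounded_measurableN.
Qed.

Lemma bounded_measurableM f g : bounded_measurable f -> bounded_measurable g ->
  bounded_measurable (fun u => f u * g u).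
Proof.
move=> [mf [C Cf]] [mg [D Dg]]; split; first exact: measurable_funM.
by exists (C * D) => u; rewrite normrM ler_pM.
Qed.

Lemma bounded_measurable_shift f e : bounded_measurable f ->
  bounded_measurable (fun u => f (u + e)).
Proof.
move=> [mf [C Cf]]; split; last by exists C.
apply: (measurableT_comp mf); exact: measurable_funD.
Qed.

Lemma bounded_measurable_integrable f a b : bounded_measurable f ->
  mu.-integrable `[a, b] (EFin \o f).
Proof.
move=> [mf [C Cf]]; apply: measurable_bounded_integrable => //.
- rewrite /= lebesgue_measure_itv/=.
  by case: ifPn => // _; rewrite -EFinB ltry.
- exact: measurable_funTS.
- exists C; split; rewrite ?num_real // => x Cx u _ /=.
  exact: le_trans (Cf u) (ltW Cx).
Qed.

Lemma Rintegral_itv_split f a b c : bounded_measurable f -> a <= b -> b <= c ->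
  \int[mu]_(u in `[a, c]) f u =
  \int[mu]_(u in `[a, b]) f u + \int[mu]_(u in `[b, c]) f u.
Proof.
move=> bf ab bc.
have := @Rintegral_itvB R f (BLeft a) (BRight c) b.
move=> /(_ (bounded_measurable_integrable f a c bf)).
rewrite !bnd_simp => /(_ ab bc).
rewrite Rintegral_itv_obnd_cbnd; first lra.
apply: (integrableS _ _ _ (bounded_measurable_integrable f b c bf)) => //.
by apply: subset_itvr; rewrite bnd_simp.
Qed.

Lemma Rintegral_itv_point f a : \int[mu]_(u in `[a, a]) f u = 0.
Proof. by rewrite set_itv1 Rintegral_set1. Qed.

Lemma fine_lebesgue_itv a b : a <= b -> fine (mu `[a, b]%classic) = b - a.
Proof.
move=> ab; rewrite lebesgue_measure_itv/= lte_fin.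
case: ltP => //= ba; by have -> : a = b; [lra|rewrite subrr].
Qed.

Lemma Rintegral_itv_cst a b c : a <= b ->
  \int[mu]_(u in `[a, b]) c = c * (b - a).
Proof. by move=> ab; rewrite Rintegral_cst// fine_lebesgue_itv. Qed.

Lemma le_Rintegral_itv f g a b : bounded_measurable f -> bounded_measurable g ->
  (forall u, a <= u <= b -> f u <= g u) ->
  \int[mu]_(u in `[a, b]) f u <= \int[mu]_(u in `[a, b]) g u.
Proof.
move=> bf bg fg; apply: le_Rintegral => //; try exact: bounded_measurable_integrable.
Qed.

Lemma ler_norm_Rintegral_itv f g a b :
  bounded_measurable f -> bounded_measurable g ->
  (forall u, a <= u <= b -> `|f u| <= g u) ->
  `|\int[mu]_(u in `[a, b]) f u| <= \int[mu]_(u in `[a, b]) g u.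
Proof.
move=> bf bg fg; apply: le_trans.
  by apply: le_normr_Rintegral => //; exact: bounded_measurable_integrable.
apply: le_Rintegral_itv => //.
case: bf => mf [C Cf]; split; first exact: measurableT_comp.
by exists C => u; rewrite normr_id.
Qed.

Lemma Rintegral_itv_add f g a b : bounded_measurable f -> bounded_measurable g ->
  \int[mu]_(u in `[a, b]) (f u + g u) =
  \int[mu]_(u in `[a, b]) f u + \int[mu]_(u in `[a, b]) g u.
Proof.
by move=> bf bg; apply: RintegralD => //; exact: bounded_measurable_integrable.
Qed.

Lemma Rintegral_itv_sub f g a b : bounded_measurable f -> bounded_measurable g ->
  \int[mu]_(u in `[a, b]) (f u - g u) =
  \int[mu]_(u in `[a, b]) f u - \int[mu]_(u in `[a, b]) g u.
Proof.
by move=> bf bg; apply: RintegralB => //; exact: bounded_measurable_integrable.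
Qed.

Lemma Rintegral_itvZ f a b c : bounded_measurable f ->
  \int[mu]_(u in `[a, b]) (c * f u) = c * \int[mu]_(u in `[a, b]) f u.
Proof.
by move=> bf; apply: RintegralZl => //; exact: bounded_measurable_integrable.
Qed.

(** The pushforward of [mu] under the translation agrees with [mu] on half-open intervals, hence on
    all measurable sets by uniqueness of Lebesgue measure. *)
Lemma Rintegral_itv_shift f a b e : bounded_measurable f ->
  \int[mu]_(u in `[a, b]) f (u + e) = \int[mu]_(u in `[a + e, b + e]) f u.
Proof.
move=> bf; rewrite /Rintegral; congr fine.
pose phi : measurableTypeR R -> measurableTypeR R := fun u : R => u + e.
have mphi : measurable_fun [set: measurableTypeR R] phi.
  exact: (@measurable_funD _ (measurableTypeR R)).
have phiE c d : phi @^-1` `[c + e, d + e] = `[c, d]%classic.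
  by apply/seteqP; split=> u /=; rewrite !in_itv/= !lerD2r.
have muE A : measurable A -> mu A = pushforward mu phi A.
  move=> mA; apply: lebesgue_measure_unique => //= _ [[p q]] _ <- /=.
  rewrite /pushforward (_ : phi @^-1` _ = `]p - e, q - e]%classic); last first.
    by apply/seteqP; split=> u /=; rewrite !in_itv/= ltrBlDr lerBrDr.
  rewrite !lebesgue_measure_itv/= !lte_fin ltrD2r; case: ifP => // _.
  by rewrite -!EFinB; congr EFin; ring.
rewrite -[in LHS]phiE.
rewrite -[LHS](@integral_pushforward _ _ (measurableTypeR R)
  (measurableTypeR R) R phi mphi mu _ (EFin \o f)) //.
- by apply: eq_measure_integral => A mA _; exact/esym/muE.
- by apply/measurable_EFinP; case: bf.
- rewrite phiE; have := bounded_measurable_shift f e bf.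
  exact: bounded_measurable_integrable.
Qed.

(** Telescoping: the integral of [f] over [[s, t + e]] is split once at [s + e] and once at [t]. *)
Lemma Rintegral_itv_increment f s t e : bounded_measurable f ->
  s <= t -> 0 <= e ->
  \int[mu]_(u in `[s, t]) (f (u + e) - f u) =
  \int[mu]_(u in `[t, t + e]) f u - \int[mu]_(u in `[s, s + e]) f u.
Proof.
move=> bf st e0; rewrite Rintegral_itv_sub//; last exact: bounded_measurable_shift.
rewrite Rintegral_itv_shift//.
have h1 := Rintegral_itv_split f s (s + e) (t + e) bf.
have h2 := Rintegral_itv_split f s t (t + e) bf.
rewrite h1 in h2; lra.
Qed.

Lemma mean_near_cst f a e c B : bounded_measurable f -> 0 < e ->
  (forall u, a <= u <= a + e -> `|f u - c| <= B) ->
  `|e^-1 * \int[mu]_(u in `[a, a + e]) f u - c| <= B.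
Proof.
move=> bf e0 fB.
have ee : a + e - a = e by lra.
have bc := bounded_measurable_cst c.
have -> : e^-1 * \int[mu]_(u in `[a, a + e]) f u - c =
    e^-1 * \int[mu]_(u in `[a, a + e]) (f u - c).
  rewrite Rintegral_itv_sub// Rintegral_itv_cst ?ee; last lra.
  by rewrite mulrBr mulrCA mulVf ?mulr1// gt_eqF.
rewrite normrM gtr0_norm ?invr_gt0// mulrC ler_pdivrMr//.
rewrite -[in leRHS]ee -Rintegral_itv_cst; last lra.
apply: ler_norm_Rintegral_itv => //; first exact: bounded_measurableB.
exact: bounded_measurable_cst.
Qed.

(** For [W] this gains a factor [e] that no pointwise bound on [W (u + e) - W u] gives, since [W]
    may jump. *)
Lemma Rintegral_increment_le f s t e : bounded_measurable f ->
  nondecreasing_fun f -> s <= t -> 0 <= e ->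
  \int[mu]_(u in `[s, t]) (f (u + e) - f u) <= e * (f (t + e) - f s).
Proof.
move=> bf fnd st e0; rewrite Rintegral_itv_increment//.
have bc c := bounded_measurable_cst c.
have h1 : \int[mu]_(u in `[t, t + e]) f u <= f (t + e) * (t + e - t).
  rewrite -Rintegral_itv_cst; last lra.
  by apply: le_Rintegral_itv => // u /andP[_ ?]; exact: fnd.
have h2 : f s * (s + e - s) <= \int[mu]_(u in `[s, s + e]) f u.
  rewrite -Rintegral_itv_cst; last lra.
  by apply: le_Rintegral_itv => // u /andP[? _]; exact: fnd.
nra.
Qed.

(* Adding a constant [C] bounding [|f|] makes the primitive nondecreasing. *)
Lemma measurable_Rintegral_itv f a : bounded_measurable f ->
  measurable_fun [set: R] (fun t => \int[mu]_(u in `[a, t]) f u).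
Proof.
move=> bf; have [_ [C Cf]] := bf.
have bC : bounded_measurable (fun=> C) by exact: bounded_measurable_cst.
have bfC := bounded_measurableD _ _ bf bC.
have nd g : bounded_measurable g -> (forall u, 0 <= g u) ->
    measurable_fun [set: R] (fun t => \int[mu]_(u in `[a, t]) g u).
  move=> bg g0; apply: nondecreasing_measurable => // s t st.
  have [as_|sa] := leP a s.
    rewrite (Rintegral_itv_split g a s t)// lerDl.
    exact: Rintegral_ge0.
  (* For [s < a] the interval is empty and its integral is 0. *)
  rewrite set_itv_ge ?Rintegral_set0; first exact: Rintegral_ge0.
  by rewrite bnd_simp -ltNge.
rewrite (_ : (fun t => _) = (fun t => \int[mu]_(u in `[a, t]) (f u + C)
                                - \int[mu]_(u in `[a, t]) C)); last first.
  by apply/funext => t; rewrite Rintegral_itv_add//; ring.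
apply: measurable_funB; apply: nd => //= u.
  by have := Cf u; rewrite ler_norml; lra.
exact: le_trans (Cf 0).
Qed.

(* [a] is approximated by step functions with values in [Z / (n + 1)]. *)
Lemma measurable_caratheodory (G : R -> R -> R) (a b : R -> R) :
  (forall c, measurable_fun [set: R] (G c)) ->
  (forall w, continuous (G^~ w)) ->
  measurable_fun [set: R] a -> measurable_fun [set: R] b ->
  measurable_fun [set: R] (fun u => G (a u) (b u)).
Proof.
move=> mG cG ma mb.
pose an n u : R := (Num.floor (n.+1%:R * a u))%:~R / n.+1%:R.
apply: (@measurable_fun_cvg _ _ R setT (fun n u => G (an n u) (b u))); last first.
  move=> u _.
  apply: (@cvg_comp _ _ _ (an ^~ u) (G^~ (b u)) _ (nbhs (a u))); last exact: cG.
  apply/cvgrPdist_le => eps eps0.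
  near=> n.
  have n0 : 0 < n.+1%:R :> R by rewrite ltr0n.
  have neps : n.+1%:R^-1 < eps.
    by near: n; exact: (near_infty_natSinv_lt (PosNum eps0)).
  have /andP[h1 h2] := floor_itv (n.+1%:R * a u).
  rewrite /an (_ : _ - _ =
    (n.+1%:R * a u - (Num.floor (n.+1%:R * a u))%:~R) / n.+1%:R); last first.
    by rewrite mulrBl mulrAC divff ?mul1r// gt_eqF.
  rewrite normrM [`|_^-1|]gtr0_norm ?invr_gt0// ger0_norm ?subr_ge0//.
  rewrite (le_trans _ (ltW neps))// ler_piMl ?invr_ge0 ?ltW//.
  by rewrite ltrBlDl -[1]/(1%:~R) -intrD.
move=> n _ B mB; rewrite setTI.
have n0 : 0 < n.+1%:R :> R by rewrite ltr0n.
(* The step function has countably many values; where it equals [k / (n + 1)], only a section of [G]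
   composed with [b] is left. *)
pose F (k : int) : set R := (a @^-1` `[k%:~R / n.+1%:R, (k + 1)%:~R / n.+1%:R[)
  `&` ((fun u => G (k%:~R / n.+1%:R) (b u)) @^-1` B).
rewrite (_ : _ @^-1` B = \bigcup_k F k).
  apply: countable_bigcupT_measurable => [|k]; first exact: countableP.
  apply: measurableI.
    rewrite -[X in measurable X]setTI; exact: ma.
  rewrite -[X in measurable X]setTI; apply: measurableT_comp => //.
have key (k : int) u : (F k u : Prop) -> Num.floor (n.+1%:R * a u) = k.
  move=> [/=]; rewrite in_itv/= => /andP[k1 k2] _; apply/eqP.
  rewrite floor_eq -ler_pdivrMl// mulrC k1/=.
  by rewrite mulrC -ltr_pdivlMr.
apply/seteqP; split=> [u /= Bu|u [k _] /[dup] /key Fk [_ /=]].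
  exists (Num.floor (n.+1%:R * a u)) => //; split => //=.
  have /andP[h1 h2] := floor_itv (n.+1%:R * a u).
  by rewrite in_itv/= ler_pdivrMr// ltr_pdivlMr// [a u * _]mulrC h1 h2.
by rewrite /an Fk.
Unshelve. all: by end_near. Qed.

End BoundedMeasurable.

(** * Trapezoid rule and functions of class C^{2,1} *)

Section Calculus.
Context {R : realType}.
Local Notation mu := (@lebesgue_measure R).
Implicit Types (f g df : R -> R) (h : R * R -> R) (a b c t w M C : R).

Lemma derivable_is_derive1 f t : derivable f t 1 -> is_derive t 1 f (derive1 f t).
Proof. by move=> df; rewrite derive1E; exact: derivableP. Qed.

Lemma derivable1_continuous f : (forall t, derivable f t 1) -> continuous f.
Proof.
move=> df t; apply: differentiable_continuous; exact/derivable1_diffP.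
Qed.

(** Clamping to [[0, 1]] extends a path to the line by its end values; clamping to [[-M, M]] makes
    Lipschitz bounds on a square global. *)
Definition clamp (lo hi t : R) : R := Num.max lo (Num.min t hi).

Lemma clamp_itv lo hi t : lo <= hi -> lo <= clamp lo hi t <= hi.
Proof.
by move=> lohi; rewrite /clamp le_max lexx ge_max ge_min lexx orbT lohi.
Qed.

Lemma clamp_id lo hi t : lo <= t <= hi -> clamp lo hi t = t.
Proof. by move=> /andP[? ?]; rewrite /clamp min_l//; exact: max_r. Qed.

Lemma clamp_homo lo hi s t : s <= t ->
  clamp lo hi s <= clamp lo hi t <= clamp lo hi s + (t - s).
Proof.
rewrite /clamp => st.
have [s1|s1] := leP s hi; have [t1|t1] := leP t hi;
  have [s2|s2] := leP lo s; have [t2|t2] := leP lo t;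
  have [h|h] := leP lo hi; apply/andP; split; lra.
Qed.

Lemma clamp_lipschitz lo hi s t :
  `|clamp lo hi s - clamp lo hi t| <= `|s - t|.
Proof.
wlog st : s t / s <= t.
  move=> wl; case/orP: (le_total s t) => [|ts]; first exact: wl.
  by rewrite distrC (distrC s); exact: wl.
have /andP[h1 h2] := clamp_homo lo hi _ _ st.
by rewrite !ler0_norm ?subr_le0// !opprB; lra.
Qed.

Lemma norm_between a b t : Num.min a b <= t <= Num.max a b ->
  `|t - a| <= `|b - a|.
Proof.
case: (lerP a b) => ?; case: (lerP a t) => ?; lra.
Qed.

Lemma norm_between_le a b t M : `|a| <= M -> `|b| <= M ->
  Num.min a b <= t <= Num.max a b -> `|t| <= M.
Proof. by rewrite !ler_norml ge_min le_max; lra. Qed.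

(** The mean value inequality without an order between [a] and [b], which will be values of the
    paths. *)
Lemma ler_norm_increment f df a b C :
  (forall t, Num.min a b <= t <= Num.max a b -> is_derive t 1 f (df t)) ->
  (forall t, Num.min a b <= t <= Num.max a b -> `|df t| <= C) ->
  `|f b - f a| <= C * `|b - a|.
Proof.
wlog ab : a b / a <= b => [wl|].
  case/orP: (le_total a b) => [/wl//|ba].
  by have := wl _ _ ba; rewrite (minC b) (maxC b) (distrC (f a)) (distrC a).
rewrite min_l// max_r// => Df dfC.
have [| |c cab ->] := @MVT_segment R f df a b ab.
- move=> t; rewrite in_itv/= => /andP[? ?]; apply: Df; lra.
- apply: derivable_within_continuous => t; rewrite in_itv/= => tab.
  by have [] := Df _ tab.
- by rewrite normrM ler_wpM2r// dfC//; move: cab; rewrite in_itv.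
Qed.

Lemma lipschitz_continuous f C : (forall a b, `|f a - f b| <= C * `|a - b|) ->
  continuous f.
Proof.
move=> fC a; apply/cvgrPdist_le => e e0; near=> b.
rewrite (le_trans (fC a b))//.
have C0 : 0 < `|C| + 1 by rewrite ltr_pwDr.
rewrite (@le_trans _ _ ((`|C| + 1) * `|a - b|))//.
  by rewrite ler_wpM2r// (le_trans (ler_norm _))// lerDl.
rewrite mulrC -ler_pdivlMr//; near: b.
by apply: cvgr_dist_le; [exact: cvg_id|rewrite divr_gt0].
Unshelve. all: by end_near. Qed.

Lemma continuous_bounded_box h M : continuous h ->
  exists2 C : R, 0 <= C & forall a w, `|a| <= M -> `|w| <= M -> `|h (a, w)| <= C.
Proof.
move=> ch.
have cM : compact (`[-M, M] `*` `[-M, M] : set (R * R)%type).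
  by apply: compact_setX; exact: segment_compact.
have cf : {within `[-M, M] `*` `[-M, M], continuous h}.
  exact: continuous_subspaceT.
have /ex_strict_bound_gt0[C C0 /= hC] := compact_bounded (continuous_compact cf cM).
exists C; first exact: ltW C0.
move=> a w aM wM; apply/ltW/hC; exists (a, w) => //.
by split; rewrite /= in_itv/= -ler_norml.
Qed.

(** As a function [phi] of the right end [t], the error has half a first-order Taylor remainder of
    [h] as derivative. This is quadratic in [t - a], and the mean value inequality supplies the
    third factor. *)
Lemma trapezoid_error (H h h' h'' : R -> R) a b C : 0 <= C ->
  (forall t, Num.min a b <= t <= Num.max a b -> is_derive t 1 H (h t)) ->
  (forall t, Num.min a b <= t <= Num.max a b -> is_derive t 1 h (h' t)) ->
  (forall t, Num.min a b <= t <= Num.max a b -> is_derive t 1 h' (h'' t)) ->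
  (forall t, Num.min a b <= t <= Num.max a b -> `|h'' t| <= C) ->
  `|H b - H a - (h a + h b) / 2 * (b - a)| <= C * `|b - a| ^+ 3.
Proof.
move=> C0 DH Dh Dh' h''C.
have sub t s : Num.min a b <= t <= Num.max a b ->
    Num.min a t <= s <= Num.max a t -> Num.min a b <= s <= Num.max a b.
  by rewrite !ge_min !le_max; lra.
have subr t s1 s2 : Num.min a b <= t <= Num.max a b ->
    Num.min a t <= s1 <= Num.max a t ->
    Num.min s1 t <= s2 <= Num.max s1 t -> Num.min a t <= s2 <= Num.max a t.
  by rewrite !ge_min !le_max; lra.
have taylor t : Num.min a b <= t <= Num.max a b ->
    `|h t - h a - h' t * (t - a)| <= C * `|t - a| ^+ 2.
  move=> tab.
  (* The remainder is an increment of [h s - h' t * s] in [s], whose derivative [h' s - h' t] is at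
     most [C * |t - a|] in absolute value. *)
  have -> : h t - h a - h' t * (t - a) = (h t - h' t * t) - (h a - h' t * a).
    by ring.
  rewrite expr2 mulrA.
  apply: (@ler_norm_increment (fun s => h s - h' t * s) (fun s => h' s - h' t)).
    move=> s sat; have Dhs := Dh _ (sub _ _ tab sat).
    apply: is_derive_eq; rewrite /GRing.scale/=; ring.
  move=> s sat; rewrite distrC.
  apply: (@le_trans _ _ (C * `|t - s|)).
    apply: (@ler_norm_increment h' h'') => s2 s2st.
      exact/Dh'/(sub _ _ tab)/(subr _ _ _ tab sat).
    exact/h''C/(sub _ _ tab)/(subr _ _ _ tab sat).
  rewrite ler_wpM2l//.
  by move: sat; case: (lerP a t) => ?; case: (lerP s t) => ?; lra.
pose phi t := H t - H a - (h a + h t) / 2 * (t - a).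
have -> : H b - H a - (h a + h b) / 2 * (b - a) = phi b - phi a.
  by rewrite /phi; ring.
rewrite exprSr mulrA.
apply: (@ler_norm_increment phi (fun t => (h t - h a - h' t * (t - a)) / 2)).
  move=> t tab; rewrite /phi; have DHt := DH _ tab; have Dht := Dh _ tab.
  apply: is_derive_eq; rewrite /GRing.scale/=; by field.
move=> t tab; rewrite normrM [`|2^-1|]gtr0_norm ?invr_gt0//.
have h1 := taylor _ tab; have h2 := norm_between _ _ _ tab.
have h3 : C * `|t - a| ^+ 2 <= C * `|b - a| ^+ 2.
  by rewrite ler_wpM2l// lerXn2r ?nnegrE.
have h4 := normr_ge0 (h t - h a - h' t * (t - a)).
lra.
Qed.

Lemma measurable_continuous_pair h (X L : R -> R) : continuous h ->
  measurable_fun [set: R] X -> measurable_fun [set: R] L ->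
  measurable_fun [set: R] (fun u => h (X u, L u)).
Proof.
move=> ch mX mL.
apply: (measurable_caratheodory (fun a w => h (a, w))) => //.
  move=> c; apply: continuous_measurable_fun => w.
  apply: (@cvg_comp _ _ _ (fun w => (c, w)) h _ (nbhs (c, w))); last exact: ch.
  by apply: (@cvg_pair _ _ _ _ (nbhs c) (nbhs w)); [exact: cvg_cst|exact: cvg_id].
move=> w a.
apply: (@cvg_comp _ _ _ (fun a => (a, w)) h _ (nbhs (a, w))); last exact: ch.
by apply: (@cvg_pair _ _ _ _ (nbhs a) (nbhs w)); [exact: cvg_id|exact: cvg_cst].
Qed.

(** Makes the results on [h] apply to [f \o h], hence to the integral of [f \o y]. The second
    derivative of [f] enters through the chain rule for [partial1 (partial1 (f \o h))]. *)
Lemma class_C21_comp f h : class_C2 f -> class_C21 h -> class_C21 (f \o h).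
Proof.
move=> [df ddf cf2] [[d1 d11 d2] [ch ch1 ch11 ch2]].
have cf := derivable1_continuous _ df.
have cf1 := derivable1_continuous _ ddf.
have chain (g k : R -> R) t : derivable g (k t) 1 -> derivable k t 1 ->
    is_derive t 1 (g \o k) (derive1 k t * derive1 g (k t)).
  move=> /derivable_is_derive1 dg /derivable_is_derive1 dk.
  have := is_derive1_comp dg dk.
  by rewrite /GRing.scale/= mulrC.
have p1 : partial1 (f \o h) = (fun p => partial1 h p * derive1 f (h p)).
  apply/funext => -[a w]; rewrite /partial1 derive1E.
  have := chain f (fun u => h (u, w)) a (df _) (d1 (a, w)).
  by move=> /@derive_val ->.
have p2 : partial2 (f \o h) = (fun p => partial2 h p * derive1 f (h p)).
  apply/funext => -[a w]; rewrite /partial2 derive1E.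
  have := chain f (fun v => h (a, v)) w (df _) (d2 (a, w)).
  by move=> /@derive_val ->.
have Dp1 (p : R * R) : is_derive p.1 1 (fun u => partial1 (f \o h) (u, p.2))
    (partial1 (partial1 h) p * derive1 f (h p) +
     partial1 h p ^+ 2 * derive1 (derive1 f) (h p)).
  rewrite p1; case: p => a w /=.
  pose F u := partial1 h (u, w); pose G := derive1 f \o (fun u => h (u, w)).
  have D1 : is_derive a 1 F (partial1 (partial1 h) (a, w)).
    exact: derivable_is_derive1 (d11 (a, w)).
  have D2 : is_derive a 1 G (partial1 h (a, w) * derive1 (derive1 f) (h (a, w))).
    exact: (chain (derive1 f) (fun u => h (u, w)) a (ddf _) (d1 (a, w))).
  have -> : (fun u => partial1 h (u, w) * derive1 f (h (u, w))) = F * G by [].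
  apply: (is_derive_eq (is_deriveM D1 D2)).
  by rewrite /GRing.scale/= /F /G/=; ring.
have p11 : partial1 (partial1 (f \o h)) = (fun p =>
    partial1 (partial1 h) p * derive1 f (h p) +
     partial1 h p ^+ 2 * derive1 (derive1 f) (h p)).
  apply/funext => p; have /@derive_val <- := Dp1 p.
  by rewrite -derive1E.
have cfh : continuous (derive1 f \o h).
  by move=> p; apply: continuous_comp; [exact: ch|exact: cf1].
have cffh : continuous (derive1 (derive1 f) \o h).
  by move=> p; apply: continuous_comp; [exact: ch|exact: cf2].
split; split.
- move=> p; have [] := chain f (fun u => h (u, p.2)) p.1 (df _) (d1 p) => //.
- by move=> p; have [] := Dp1 p.
- move=> p; have [] := chain f (fun v => h (p.1, v)) p.2 (df _) (d2 p) => //.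
- by move=> p; apply: continuous_comp; [exact: ch|exact: cf].
- by rewrite p1 => p; apply: cvgM; [exact: ch1|exact: cfh].
- rewrite p11 => p; apply: cvgD; apply: cvgM; [exact: ch11|exact: cfh| |exact: cffh].
  by apply: cvgM; exact: ch1.
- by rewrite p2 => p; apply: cvgM; [exact: ch2|exact: cfh].
Qed.

Lemma near_right0_ex (P : R -> Prop) : (\forall d \near 0^'+, P d) ->
  exists2 delta : R, 0 < delta & forall d, 0 < d < delta -> P d.
Proof.
rewrite near_withinE => /nbhs_ballP[delta /= delta0 dP].
exists delta => // d /andP[d0 ddelta]; apply: dP => //.
by rewrite /ball/= sub0r normrN gtr0_norm.
Qed.

(** Samples limits at [0^'+] along a sequence, since measurability passes to limits of sequences. *)
Lemma natSinv_at_right : n.+1%:R^-1 @[n --> \oo] --> (0 : R)^'+.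
Proof.
move=> P /near_right0_ex[delta delta0 dP].
rewrite /nbhs/=; near=> n; apply: dP; rewrite invr_gt0 ltr0n/=.
by near: n; exact: (near_infty_natSinv_lt (PosNum delta0)).
Unshelve. all: by end_near. Qed.

End Calculus.

(** * Antiderivatives in the first variable *)

Section Primitive.
Context {R : realType}.
Local Notation mu := (@lebesgue_measure R).

(* [H] plays the role of an antiderivative of [h] in the first variable, on the
   square [-M, M]^2. *)
Record trapezoid_primitive (h : R * R -> R) (M C : R) (H : R -> R -> R) : Prop :=
  TrapezoidPrimitive {
  tp_bound : forall a w : R, `|a| <= M -> `|w| <= M -> `|h (a, w)| <= C;
  tp_lip2 : forall a w w' : R, `|a| <= M -> `|w| <= M -> `|w'| <= M ->
    `|h (a, w) - h (a, w')| <= C * `|w - w'|;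
  tp_trapezoid : forall a b w : R, `|a| <= M -> `|b| <= M -> `|w| <= M ->
    `|H b w - H a w - (h (a, w) + h (b, w)) / 2 * (b - a)| <=
      C * `|b - a| ^+ 3;
  tp_rect : forall a b w w' : R,
    `|a| <= M -> `|b| <= M -> `|w| <= M -> `|w'| <= M ->
    `|(H b w - H a w) - (H b w' - H a w')| <= C * `|w - w'| * `|b - a|;
  tp_lip1 : forall a b w : R, `|a| <= M -> `|b| <= M -> `|w| <= M ->
    `|H b w - H a w| <= C * `|b - a|;
  tp_measurable : forall X L : R -> R,
    measurable_fun [set: R] X -> measurable_fun [set: R] L ->
    (forall u, `|X u| <= M) -> (forall u, `|L u| <= M) ->
    measurable_fun [set: R] (fun u => H (X u) (L u)) }.

(** [H b w] is the integral of [h (v, w)] in [v] from [-M] to [b]. The bounds follow from the mean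
    value inequality and the trapezoid rule; [C] adds up bounds for [h], [partial1 (partial1 h)] and
    [partial2 h] on the square. *)
Lemma C21_primitive (h : R * R -> R) (M : R) : 0 <= M -> class_C21 h ->
  exists C H, 0 <= C /\ trapezoid_primitive h M C H.
Proof.
move=> M0 [[d1 d11 d2] [ch ch1 ch11 ch2]].
have [C0 C00 hC0] := continuous_bounded_box h M ch.
have [C1 C10 hC1] := continuous_bounded_box _ M ch11.
have [C2 C20 hC2] := continuous_bounded_box _ M ch2.
pose C : R := C0 + C1 + C2.
(* Starting at [-(M + 1)] makes [-M] an interior point, where the fundamental theorem of calculus
   gives a two-sided derivative. *)
pose K (b w : R) : R := \int[mu]_(v in `[- (M + 1), b]) h (v, w).
pose H (b w : R) : R := K b w - K (- M) w.
have cw (w : R) : continuous (fun v => h (v, w)).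
  by apply: derivable1_continuous => t; exact: (d1 (t, w)).
have DH (w t : R) : `|t| <= M -> is_derive t 1 (H^~ w) (h (t, w)).
  rewrite ler_norml => /andP[Mt tM].
  have tM1 : t < M + 1 by lra.
  have [| | |DK KE] := @continuous_FTC1_closed R (fun v => h (v, w)) (- (M + 1)) t
    (M + 1) tM1.
  - apply: continuous_compact_integrable; first exact: segment_compact.
    by apply: continuous_subspaceT; exact: cw.
  - lra.
  - exact: cw.
  have DKt : is_derive t 1 (K^~ w) (h (t, w)).
    by rewrite -KE; exact: derivable_is_derive1.
  have Dc : is_derive t 1 (fun=> - K (- M) w) 0 by exact: is_derive_cst.
  by apply: (is_derive_eq (is_deriveD DKt Dc)); rewrite addr0.
have Dh (w t : R) : is_derive t 1 (fun v => h (v, w)) (partial1 h (t, w)).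
  exact: derivable_is_derive1 (d1 (t, w)).
have Dh1 (w t : R) : is_derive t 1 (fun v => partial1 h (v, w))
    (partial1 (partial1 h) (t, w)).
  exact: derivable_is_derive1 (d11 (t, w)).
have Dh2 (a t : R) : is_derive t 1 (fun v => h (a, v)) (partial2 h (a, t)).
  exact: derivable_is_derive1 (d2 (a, t)).
have lip2 (a w w' : R) : `|a| <= M -> `|w| <= M -> `|w'| <= M ->
    `|h (a, w) - h (a, w')| <= C * `|w - w'|.
  move=> aM wM w'M.
  apply: (@le_trans _ _ (C2 * `|w - w'|)).
    apply: (ler_norm_increment (fun v => h (a, v)) (fun v => partial2 h (a, v))).
    by move=> t /norm_between_le tM; apply: hC2; [|exact: tM].
  rewrite ler_wpM2r// /C; lra.
have rect (a b w w' : R) : `|a| <= M -> `|b| <= M -> `|w| <= M -> `|w'| <= M ->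
    `|(H b w - H a w) - (H b w' - H a w')| <= C * `|w - w'| * `|b - a|.
  move=> aM bM wM w'M.
  (* Regrouped as an increment in the first variable, of a function with derivative
     [h (t, w) - h (t, w')]. *)
  have -> : (H b w - H a w) - (H b w' - H a w') =
    (H b w - H b w') - (H a w - H a w') by ring.
  apply: (ler_norm_increment (fun t => H t w - H t w')
    (fun t => h (t, w) - h (t, w'))) => t /norm_between_le tM.
    have D1 := DH w t (tM _ aM bM); have D2 := DH w' t (tM _ aM bM).
    exact: (is_deriveB D1 D2).
  by apply: lip2 => //; exact: tM.
have lip1 (a b w : R) : `|a| <= M -> `|b| <= M -> `|w| <= M ->
    `|H b w - H a w| <= C * `|b - a|.
  move=> aM bM wM; apply: (@le_trans _ _ (C0 * `|b - a|)).
    apply: (ler_norm_increment (H^~ w) (fun t => h (t, w))) => t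
      /norm_between_le tM.
      exact/DH/tM.
    by apply: hC0 => //; exact: tM.
  by rewrite ler_wpM2r// /C; lra.
exists C, H; split; first by rewrite /C; lra.
split=> //.
- move=> a w aM wM; apply: le_trans (hC0 _ _ aM wM) _; rewrite /C; lra.
- move=> a b w aM bM wM.
  apply: (@le_trans _ _ (C1 * `|b - a| ^+ 3)); last first.
    by rewrite ler_wpM2r ?exprn_ge0// /C; lra.
  apply: (trapezoid_error (H^~ w) (fun v => h (v, w)) (fun v => partial1 h (v, w))
    (fun v => partial1 (partial1 h) (v, w))) => // t /norm_between_le tM.
    exact/DH/tM.
  by apply: hC1 => //; exact: tM.
- move=> X L mX mL XM LM.
  (* Clamping keeps the values of [X] and [L] and makes [H] continuous in each variable on the whole
     line. *)
  pose cl := clamp (- M) M.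
  have clE t : `|t| <= M -> cl t = t by rewrite ler_norml; exact: clamp_id.
  have clM t : `|cl t| <= M by rewrite ler_norml; apply: clamp_itv; lra.
  have cl1 s t : `|cl s - cl t| <= `|s - t| by exact: clamp_lipschitz.
  rewrite (_ : (fun u => _) = (fun u => H (cl (X u)) (cl (L u)))); last first.
    by apply/funext => u; rewrite !clE.
  apply: (measurable_caratheodory (fun c w => H (cl c) (cl w))) => //.
    move=> c; apply: continuous_measurable_fun.
    apply: (lipschitz_continuous _ (C * (2 * M))) => w w'.
    have MM : `|- M| <= M by rewrite normrN ger0_norm.
    (* As [H] vanishes at [-M], the rectangular bound based there is a Lipschitz bound in the second
       variable. *)
    have := rect (- M) (cl c) (cl w) (cl w') MM (clM c) (clM w) (clM w').
    rewrite /H !subrr !subr0 => /le_trans; apply.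
    rewrite mulrAC ler_pM ?mulr_ge0//; first by rewrite /C; lra.
    rewrite ler_wpM2l//; first by rewrite /C; lra.
    have := clM c; rewrite ler_norml => ?; rewrite ler_norml; lra.
  move=> w; apply: (lipschitz_continuous _ C) => s t.
  apply: le_trans (lip1 (cl t) (cl s) (cl w) (clM _) (clM _) (clM _)) _.
  by rewrite ler_wpM2l// /C; lra.
Qed.

End Primitive.

Arguments tp_bound {R h M C H}.
Arguments tp_lip2 {R h M C H}.
Arguments tp_trapezoid {R h M C H}.
Arguments tp_rect {R h M C H}.
Arguments tp_lip1 {R h M C H}.
Arguments tp_measurable {R h M C H}.

(** * The symmetric integral along a path with one rough and one BV coordinate *)

Section TrapezoidApproximation.
Context {R : realType}.
Local Notation mu := (@lebesgue_measure R).
Variables (X L W om : R -> R) (M V : R).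

(** [om] is a modulus of continuity of [X]; that its cube is [o(e)] is where [alpha > 1/3] enters.
    [W] stands for the total variation function of [L]. The bounds hold on the whole line because
    the times [u + e] may leave [[0, 1]]. *)
Record control : Prop := Control {
  ct_mX : measurable_fun [set: R] X;
  ct_mL : measurable_fun [set: R] L;
  ct_XM : forall u, `|X u| <= M;
  ct_LM : forall u, `|L u| <= M;
  ct_W0 : forall u, 0 <= W u;
  ct_WV : forall u, W u <= V;
  ct_LW : forall s t, s <= t -> `|L t - L s| <= W t - W s;
  ct_X : forall s t, s <= t -> `|X t - X s| <= om (t - s);
  ct_om0 : forall d, 0 <= om d;
  ct_om : forall d d', 0 <= d -> d <= d' -> om d <= om d';
  ct_om_cvg : om e @[e --> 0^'+] --> 0;
  ct_om3_cvg : om e ^+ 3 / e @[e --> 0^'+] --> 0 }.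

Hypothesis ct : control.

Lemma control_W_homo : nondecreasing_fun W.
Proof.
by move=> s t st; have := ct_LW ct _ _ st; have := normr_ge0 (L t - L s); lra.
Qed.

Lemma control_W_le s t s' t' : s' <= s -> t <= t' -> W t - W s <= W t' - W s'.
Proof.
move=> ss tt; have := control_W_homo _ _ ss; have := control_W_homo _ _ tt; lra.
Qed.

Lemma bounded_measurable_X : bounded_measurable X.
Proof. by split; [exact: (ct_mX ct)|exists M; exact: (ct_XM ct)]. Qed.

Lemma bounded_measurable_W : bounded_measurable W.
Proof.
split; first by apply: nondecreasing_measurable => //; exact: control_W_homo.
by exists V => u; rewrite ger0_norm ?(ct_W0 ct)// (ct_WV ct).
Qed.

Section Integrand.
Variables (h : R * R -> R) (H : R -> R -> R) (C : R).
Hypotheses (C0 : 0 <= C) (hH : trapezoid_primitive h M C H)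
  (mh : measurable_fun [set: R] (fun u => h (X u, L u))).

Let Y u := h (X u, L u).

Definition quot_integrand e u := (Y (u + e) + Y u) / 2 * (X (u + e) - X u).

Definition quot_mean s t e :=
  e^-1 * \int[mu]_(u in `[s, t]) quot_integrand e u.

Definition trapezoid s t := (Y s + Y t) / 2 * (X t - X s).

Lemma bounded_measurable_Y : bounded_measurable Y.
Proof.
split=> //; exists C => u.
by apply: (tp_bound hH); [exact: (ct_XM ct)|exact: (ct_LM ct)].
Qed.

Lemma bounded_measurable_quot e : bounded_measurable (quot_integrand e).
Proof.
have bY := bounded_measurable_Y; have bX := bounded_measurable_X.
apply: bounded_measurableM; last first.
  by apply: bounded_measurableB => //; exact: bounded_measurable_shift.
apply: (bounded_measurableM _ _ _ (bounded_measurable_cst _)).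
by apply: bounded_measurableD => //; exact: bounded_measurable_shift.
Qed.

Lemma bounded_measurable_primitive xi :
  `|xi| <= M -> bounded_measurable (fun u => H (X u) (L u) - H xi (L u)).
Proof.
move=> xiM; have XM := ct_XM ct; have LM := ct_LM ct; split.
  apply: measurable_funB; apply: (tp_measurable hH) => //;
    by [exact: (ct_mX ct)|exact: (ct_mL ct)].
exists (C * (2 * M)) => u; apply: le_trans (tp_lip1 hH _ _ _ _ _ _) _ => //.
rewrite ler_wpM2l// (le_trans (ler_normB _ _))//.
by have := XM u; lra.
Qed.

(* With [D u = H (X u) (L u) - H (X s) (L u)], the increment [D (u + e) - D u]
   is the trapezoidal term up to the second order rectangle increment of [H]. *)
Lemma quot_integrand_increment e s t u (D := fun v => H (X v) (L v) - H (X s) (L v)) :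
  0 <= e -> s <= u <= t ->
  `|quot_integrand e u - (D (u + e) - D u)| <=
  C * (om e ^+ 3 + (W (u + e) - W u) * (om e + om (t - s))).
Proof.
move=> e0 /andP[su ut]; rewrite /quot_integrand /D /Y.
have ue : u <= u + e by lra.
have XM := ct_XM ct; have LM := ct_LM ct.
have h1 := tp_trapezoid hH _ _ _ (XM u) (XM (u + e)) (LM (u + e)).
have h2 := tp_lip2 hH _ _ _ (XM u) (LM u) (LM (u + e)).
have h3 := tp_rect hH _ _ _ _ (XM s) (XM u) (LM (u + e)) (LM u).
have h4 := ct_LW ct _ _ ue; have h5 := ct_X ct _ _ ue.
rewrite (_ : u + e - u = e) in h5; last by lra.
have h6 : `|X u - X s| <= om (t - s).
  by apply: le_trans (ct_X ct _ _ su) _; apply: (ct_om ct); lra.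
have o1 := ct_om0 ct e; have o2 := ct_om0 ct (t - s).
set dW := W (u + e) - W u in h4 *.
have dW0 : 0 <= dW by apply: le_trans h4.
(* Three errors: the trapezoid rule with second variable frozen at [L (u + e)], the change from
   [L u] to [L (u + e)] in [h (X u, _)], and the rectangular increment of [H]. *)
have -> : (h (X (u + e), L (u + e)) + h (X u, L u)) / 2 * (X (u + e) - X u) -
   (H (X (u + e)) (L (u + e)) - H (X s) (L (u + e)) -
     (H (X u) (L u) - H (X s) (L u))) =
  - (H (X (u + e)) (L (u + e)) - H (X u) (L (u + e)) -
     (h (X u, L (u + e)) + h (X (u + e), L (u + e))) / 2 * (X (u + e) - X u))
  + (h (X u, L u) - h (X u, L (u + e))) / 2 * (X (u + e) - X u)
  - ((H (X u) (L (u + e)) - H (X s) (L (u + e))) -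
     (H (X u) (L u) - H (X s) (L u))) by field.
rewrite (le_trans (ler_normB _ _))// (le_trans (lerD (ler_normD _ _) (lexx _)))//.
rewrite normrN.
have b1 : C * `|X (u + e) - X u| ^+ 3 <= C * om e ^+ 3.
  by rewrite ler_wpM2l// lerXn2r ?nnegrE.
have b2 : `|(h (X u, L u) - h (X u, L (u + e))) / 2 * (X (u + e) - X u)| <=
    C * dW * om e.
  rewrite normrM ler_pM// normrM [`|2^-1|]gtr0_norm ?invr_gt0//.
  rewrite distrC in h4.
  have := ler_wpM2l C0 h4; have := normr_ge0 (h (X u, L u) - h (X u, L (u + e))).
  lra.
have b3 : C * `|L (u + e) - L u| * `|X u - X s| <= C * dW * om (t - s).
  by rewrite ler_pM ?mulr_ge0// ler_wpM2l.
lra.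
Qed.

(** Telescoping leaves the mean of [D] after [t] minus the mean of [D] after [s]. The last bracket
    of the bound vanishes with [e]; the rest is the local error to be summed over a partition. *)
Lemma quot_mean_trapezoid s t e : 0 < e -> s <= t ->
  `|quot_mean s t e - trapezoid s t| <=
  C * (om (t - s) ^+ 3 + 2 * (W (t + e) - W s) * om (t - s)
    + (om e ^+ 3 / e * (t - s) + (2 + (W (t + e) - W s)) * om e)).
Proof.
move=> e0 st.
pose D v := H (X v) (L v) - H (X s) (L v).
have XM := ct_XM ct; have LM := ct_LM ct.
have bD : bounded_measurable D by exact: bounded_measurable_primitive.
have bDD : bounded_measurable (fun u => D (u + e) - D u).
  by apply: bounded_measurableB => //; exact: bounded_measurable_shift.
have bW := bounded_measurable_W.
have bWW : bounded_measurable (fun u => W (u + e) - W u).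
  by apply: bounded_measurableB => //; exact: bounded_measurable_shift.
have bQ := bounded_measurable_quot e.
have bc c : bounded_measurable (fun=> c) := bounded_measurable_cst c.
have o1 := ct_om0 ct e; have o2 := ct_om0 ct (t - s).
set dW := W (t + e) - W s.
(* The increments of [W] are integrated before the division by [e], so they contribute [dW] and not
   [dW / e]. *)
have part1 : `|quot_mean s t e - (e^-1 * \int[mu]_(u in `[t, t + e]) D u
     - e^-1 * \int[mu]_(u in `[s, s + e]) D u)| <=
   C * (om e ^+ 3 / e * (t - s) + dW * (om e + om (t - s))).
  have e0' := ltW e0.
  rewrite -mulrBr -Rintegral_itv_increment// /quot_mean -mulrBr.
  rewrite -Rintegral_itv_sub// normrM gtr0_norm ?invr_gt0//.
  rewrite mulrC ler_pdivrMr//.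
  apply: (@le_trans _ _ (\int[mu]_(u in `[s, t])
      (C * (om e ^+ 3 + (W (u + e) - W u) * (om e + om (t - s)))))).
    apply: ler_norm_Rintegral_itv.
    - exact: bounded_measurableB.
    - by do ![apply: bounded_measurableM => //|apply: bounded_measurableD => //].
    - by move=> u sut; apply: quot_integrand_increment => //; exact: ltW.
  rewrite Rintegral_itvZ; last first.
    by do ![apply: bounded_measurableM => //|apply: bounded_measurableD => //].
  rewrite -[leRHS]mulrA ler_wpM2l// Rintegral_itv_add//; last exact: bounded_measurableM.
  rewrite Rintegral_itv_cst//.
  under eq_Rintegral do rewrite mulrC.
  rewrite Rintegral_itvZ//.
  have -> : (om e ^+ 3 / e * (t - s) + dW * (om e + om (t - s))) * e =
      om e ^+ 3 * (t - s) + (om e + om (t - s)) * (e * dW).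
    by field; rewrite gt_eqF.
  rewrite lerD2l ler_wpM2l ?addr_ge0//.
  by apply: Rintegral_increment_le => //; exact: control_W_homo.
have part2 : `|e^-1 * \int[mu]_(u in `[s, s + e]) D u - 0| <= C * om e.
  apply: mean_near_cst => // u /andP[su use]; rewrite subr0 /D.
  apply: le_trans (tp_lip1 hH _ _ _ (XM _) (XM _) (LM _)) _.
  rewrite ler_wpM2l// (le_trans (ct_X ct _ _ su))//; apply: (ct_om ct); lra.
have part3 : `|e^-1 * \int[mu]_(u in `[t, t + e]) D u - trapezoid s t| <=
    C * (om e + om (t - s) ^+ 3 + dW * om (t - s)).
  apply: mean_near_cst => // u /andP[tu ute].
  have h1 : `|H (X u) (L u) - H (X t) (L u)| <= C * om e.
    apply: le_trans (tp_lip1 hH _ _ _ (XM _) (XM _) (LM _)) _.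
    rewrite ler_wpM2l// (le_trans (ct_X ct _ _ tu))//; apply: (ct_om ct); lra.
  have h2 := tp_trapezoid hH _ _ _ (XM s) (XM t) (LM u).
  have h3 := tp_lip2 hH _ _ _ (XM s) (LM u) (LM s).
  have h4 := tp_lip2 hH _ _ _ (XM t) (LM u) (LM t).
  have su : s <= u by lra.
  have h5 := ct_LW ct _ _ su; have h6 := ct_LW ct _ _ tu.
  have h7 : W u - W s <= dW by apply: control_W_le; lra.
  have h8 : W u - W t <= dW by apply: control_W_le; lra.
  have h9 := ct_X ct _ _ st.
  rewrite /D /trapezoid /Y.
  (* With the second variable frozen at [L u]: the move from [X u] to [X t], the trapezoid rule
     between [X s] and [X t], then the return from [L u] to [L s] and [L t] inside [h]. *)
  have -> : H (X u) (L u) - H (X s) (L u) -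
      (h (X s, L s) + h (X t, L t)) / 2 * (X t - X s) =
    (H (X u) (L u) - H (X t) (L u))
    + (H (X t) (L u) - H (X s) (L u) -
        (h (X s, L u) + h (X t, L u)) / 2 * (X t - X s))
    + ((h (X s, L u) - h (X s, L s)) + (h (X t, L u) - h (X t, L t))) / 2
       * (X t - X s) by field.
  rewrite (le_trans (ler_normD _ _))// (le_trans (lerD (ler_normD _ _) (lexx _)))//.
  have b1 : C * `|X t - X s| ^+ 3 <= C * om (t - s) ^+ 3.
    by rewrite ler_wpM2l// lerXn2r ?nnegrE.
  have b2 : `|((h (X s, L u) - h (X s, L s)) + (h (X t, L u) - h (X t, L t))) / 2
       * (X t - X s)| <= C * dW * om (t - s).
    rewrite normrM ler_pM// normrM [`|2^-1|]gtr0_norm ?invr_gt0//.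
    have k1 := ler_wpM2l C0 (le_trans h5 h7).
    have k2 := ler_wpM2l C0 (le_trans h6 h8).
    have := ler_normD (h (X s, L u) - h (X s, L s)) (h (X t, L u) - h (X t, L t)).
    lra.
  lra.
rewrite subr0 in part2.
set q := quot_mean s t e in part1 *; set p := trapezoid s t in part3 *.
set d1 := e^-1 * _ in part1 part3; set d2 := e^-1 * _ in part1 part2.
have -> : q - p = (q - (d1 - d2)) + ((d1 - p) - d2) by ring.
rewrite (le_trans (ler_normD _ _))// (le_trans (lerD (lexx _) (ler_normB _ _)))//.
lra.
Qed.

Lemma quot_mean_split r s t e : r <= s -> s <= t ->
  quot_mean r t e = quot_mean r s e + quot_mean s t e.
Proof.
move=> rs st; rewrite /quot_mean (Rintegral_itv_split _ r s t)//; first exact: mulrDr.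
exact: bounded_measurable_quot.
Qed.

Lemma quot_mean_point r e : quot_mean r r e = 0.
Proof. by rewrite /quot_mean Rintegral_itv_point mulr0. Qed.

(** Since [e <= d], the increment of [W] for cell [i] is at most [W (u i.+2) - W (u i)]. These sum
    to the four values of [W] in the bound, which stay bounded however fine the partition is. *)
Lemma quot_mean_partition r d e n (u := fun i : nat => r + i%:R * d) :
  0 < e -> e <= d ->
  `|quot_mean r (u n) e - \sum_(i < n) trapezoid (u i) (u i.+1)| <=
  C * (n%:R * om d ^+ 3
       + 2 * (W (u n.+1) + W (u n) - W (u 1%N) - W (u 0%N)) * om d
       + n%:R * (om e ^+ 3 / e * d + (2 + V) * om e)).
Proof.
move=> e0 ed; have o1 := ct_om0 ct e; have o2 := ct_om0 ct d.
elim: n => [|n IH].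
  have -> : u 0%N = r by rewrite /u mul0r addr0.
  rewrite big_ord0 quot_mean_point subr0 normr0 mulr_ge0// !mul0r; lra.
have uS i : u i.+1 = u i + d by rewrite /u -natr1; ring.
have un i : r <= u i by rewrite /u lerDl mulr_ge0//; lra.
rewrite (quot_mean_split _ (u n))//; last by rewrite uS; lra.
rewrite big_ord_recr/= opprD addrACA.
have uu : u n <= u n.+1 by rewrite uS; lra.
have := quot_mean_trapezoid _ _ _ e0 uu.
have -> : u n.+1 - u n = d by rewrite uS; ring.
have Wn : W (u n.+1 + e) - W (u n) <= W (u n.+2) - W (u n).
  by apply: control_W_le => //; rewrite (uS n.+1) lerD2l.
have Wn0 : 0 <= W (u n.+1 + e) - W (u n).
  by rewrite subr_ge0; apply: control_W_homo; rewrite uS; lra.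
have WV : W (u n.+1 + e) - W (u n) <= V.
  by have := ct_WV ct (u n.+1 + e); have := ct_W0 ct (u n); lra.
move=> key; apply: le_trans (ler_normD _ _) (le_trans (lerD IH key) _).
rewrite -mulrDr ler_wpM2l// -natr1.
have k1 := ler_wpM2r o2 Wn; have k2 := ler_wpM2r o1 WV.
lra.
Qed.

Lemma ct_error_cvg a b :
  (om e ^+ 3 / e * a + b * om e) @[e --> 0^'+] --> 0.
Proof.
rewrite -[X in _ --> X](_ : 0 * a + b * 0 = 0); last by rewrite mul0r mulr0 addr0.
apply: cvgD; first by apply: cvgMl; exact: (ct_om3_cvg ct).
by apply: cvgMr; exact: (ct_om_cvg ct).
Qed.

(** Cauchy criterion around a fixed sum of [trapezoid]. The mesh [d] is chosen first, to make
    [n%:R * om d ^+ 3], which is [om d ^+ 3 / d * (s - r)], and the [W] terms small; then [e] tends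
    to 0 with [n] fixed. *)
Lemma quot_mean_cvg r s : cvg (quot_mean r s e @[e --> 0^'+]).
Proof.
have [sr|rs] := leP s r.
  have [->|nsr] := eqVneq s r.
    rewrite (_ : quot_mean r r = fun=> 0); first exact: is_cvg_cst.
    by apply/funext => e; rewrite quot_mean_point.
  (* For [s < r] the interval is empty and the means are 0. *)
  rewrite (_ : quot_mean r s = fun=> 0); first exact: is_cvg_cst.
  apply/funext => e; rewrite /quot_mean set_itv_ge ?Rintegral_set0 ?mulr0//.
  by rewrite bnd_simp -ltNge lt_neqAle nsr.
apply/cauchy_cvgP/cauchy_exP => eta eta0.
have V0 : 0 <= V by apply: le_trans (ct_W0 ct 0) (ct_WV ct 0).
have eta4 : 0 < eta / 4 by rewrite divr_gt0.
have D0 : 0 < s - r by rewrite subr_gt0.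
(* [4 * V] is the factor 2 of the partition estimate times the bound [2 * V] on the telescoped
   values of [W]. *)
have [delta delta0 Hdelta] : exists2 delta : R, 0 < delta & forall d,
    0 < d < delta -> C * (om d ^+ 3 / d * (s - r) + 4 * V * om d) <= eta / 4.
  apply: near_right0_ex; apply: (cvgr_le 0) => //.
  rewrite -[X in _ --> X](mulr0 C).
  by apply: cvgMr; exact: ct_error_cvg.
pose n := Num.bound ((s - r) / delta).
have nlt : (s - r) / delta < n%:R by rewrite archi_boundP// divr_ge0// ltW.
have n0 : 0 < n%:R :> R by apply: le_lt_trans nlt; rewrite divr_ge0// ltW.
pose d := (s - r) / n%:R.
have d0 : 0 < d by rewrite divr_gt0.
have dd : d < delta by rewrite ltr_pdivrMr// mulrC -ltr_pdivrMr.
pose u (i : nat) := r + i%:R * d.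
exists (\sum_(i < n) trapezoid (u i) (u i.+1)).
change (\forall e \near (0 : R)^'+,
  ball (\sum_(i < n) trapezoid (u i) (u i.+1)) eta (quot_mean r s e)).
near=> e.
have e0 : 0 < e by near: e; exact: nbhs_right_gt.
have ed : e <= d by near: e; exact: nbhs_right_le.
have He : C * n%:R * (om e ^+ 3 / e * d + (2 + V) * om e) <= eta / 4.
  near: e; apply: (cvgr_le 0) => //.
  rewrite -[X in _ --> X](mulr0 (C * n%:R)).
  by apply: cvgMr; exact: ct_error_cvg.
rewrite /ball/= distrC.
have us : u n = s by rewrite /u /d mulrC divfK ?gt_eqF// addrC subrK.
have key : `|quot_mean r (u n) e - \sum_(i < n) trapezoid (u i) (u i.+1)| <=
  C * (n%:R * om d ^+ 3
       + 2 * (W (u n.+1) + W (u n) - W (u 1%N) - W (u 0%N)) * om d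
       + n%:R * (om e ^+ 3 / e * d + (2 + V) * om e)).
  exact: quot_mean_partition.
rewrite us in key; apply: le_lt_trans key _.
have := Hdelta d; rewrite d0 dd => /(_ isT).
have -> : om d ^+ 3 / d * (s - r) = n%:R * om d ^+ 3.
  by rewrite /d; field; rewrite !gt_eqF.
have WW : W (u n.+1) + W s - W (u 1%N) - W (u 0%N) <= 2 * V.
  have := ct_WV ct (u n.+1); have := ct_WV ct s.
  have := ct_W0 ct (u 1%N); have := ct_W0 ct (u 0%N); lra.
have := ler_wpM2l C0 (ler_wpM2r (ct_om0 ct d) WW).
lra.
Unshelve. all: by end_near. Qed.

Definition quot_lim s t := lim (quot_mean s t e @[e --> 0^'+]).

Lemma quot_lim_split r s t : r <= s -> s <= t ->
  quot_lim r t = quot_lim r s + quot_lim s t.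
Proof.
move=> rs st; apply: cvg_lim => //.
rewrite (_ : quot_mean r t = fun e => quot_mean r s e + quot_mean s t e).
  by apply: cvgD; exact: quot_mean_cvg.
by apply/funext => e; exact: quot_mean_split.
Qed.

(** The limit of [quot_mean_trapezoid]. As [W] may jump at [t], [W (t + e)] is first bounded by the
    fixed [W (t + delta)]. *)
Lemma quot_lim_trapezoid s t delta : s <= t -> 0 < delta ->
  `|quot_lim s t - trapezoid s t| <=
  C * (om (t - s) ^+ 3 + 2 * (W (t + delta) - W s) * om (t - s)).
Proof.
move=> st delta0.
have lhs : `|quot_mean s t e - trapezoid s t| @[e --> 0^'+] -->
    `|quot_lim s t - trapezoid s t|.
  by apply: cvg_norm; apply: cvgB; [exact: quot_mean_cvg|exact: cvg_cst].
have rhs : C * (om (t - s) ^+ 3 + 2 * (W (t + delta) - W s) * om (t - s)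
    + (om e ^+ 3 / e * (t - s) + (2 + V) * om e)) @[e --> 0^'+] -->
  C * (om (t - s) ^+ 3 + 2 * (W (t + delta) - W s) * om (t - s) + 0).
  by apply: cvgMr; apply: cvgD; [exact: cvg_cst|exact: ct_error_cvg].
rewrite addr0 in rhs; apply: ler_cvg_to lhs rhs _.
near=> e.
have e0 : 0 < e by near: e; exact: nbhs_right_gt.
have ed : e <= delta by near: e; exact: nbhs_right_le.
apply: le_trans (quot_mean_trapezoid _ _ _ e0 st) _; rewrite ler_wpM2l//.
have o1 := ct_om0 ct e; have o2 : 0 <= om (t - s) := ct_om0 ct _.
have W1 : W (t + e) - W s <= W (t + delta) - W s.
  by apply: control_W_le => //; rewrite lerD2l.
have W2 : W (t + e) - W s <= V.
  by have := ct_WV ct (t + e); have := ct_W0 ct s; lra.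
have := ler_wpM2r o2 W1; have := ler_wpM2r o1 W2; lra.
Unshelve. all: by end_near. Qed.

Lemma measurable_quot_lim r : measurable_fun [set: R] (quot_lim r).
Proof.
apply: (@measurable_fun_cvg _ _ R setT (fun n t => quot_mean r t n.+1%:R^-1)).
  move=> n; apply: measurable_funM => //; apply: measurable_Rintegral_itv.
  exact: bounded_measurable_quot.
move=> t _.
apply: (@cvg_comp _ _ _ (fun n : nat => n.+1%:R^-1 : R) (quot_mean r t) _ (0^'+)).
  exact: natSinv_at_right.
exact: quot_mean_cvg.
Qed.

(** [A] at the times [s] and [s + e], through the extended paths. [trapezoid] takes unclamped times
    because these paths will be constant on each side of [[0, 1]]. *)
Definition area e s :=
  quot_lim (clamp 0 1 s) (clamp 0 1 (s + e)) - trapezoid s (s + e).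

Hypotheses (Xclamp : forall u, X (clamp 0 1 u) = X u)
  (Lclamp : forall u, L (clamp 0 1 u) = L u).

(** [quot_lim_trapezoid] with [delta = e]: the clamped right end is at most [s + e], whence
    [s + 2 * e]. *)
Lemma area_bound e s : 0 < e -> 0 <= s <= 1 ->
  `|area e s| <= C * (om e ^+ 3 + 2 * (W (s + 2 * e) - W s) * om e).
Proof.
move=> e0 s01.
have ss : clamp 0 1 s = s by exact: clamp_id.
have -> : area e s = quot_lim s (clamp 0 1 (s + e)) - trapezoid s (clamp 0 1 (s + e)).
  by rewrite /area /trapezoid /Y !Xclamp !Lclamp ss.
have /andP[t1 t2] : s <= clamp 0 1 (s + e) <= s + e.
  by have := clamp_homo 0 1 s (s + e); rewrite ss => /(_ ltac:(lra)); lra.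
apply: le_trans (quot_lim_trapezoid _ _ _ t1 e0) _; rewrite ler_wpM2l//.
have o1 : om (clamp 0 1 (s + e) - s) <= om e by apply: (ct_om ct); lra.
have o2 := ct_om0 ct (clamp 0 1 (s + e) - s).
have o3 := ct_om0 ct e.
apply: lerD; first by rewrite lerXn2r ?nnegrE.
apply: ler_pM => //.
  rewrite mulr_ge0// subr_ge0; apply: control_W_homo; lra.
rewrite ler_wpM2l//; apply: control_W_le => //; lra.
Qed.

(** By additivity the limit between two moving ends is a difference of values of the single
    measurable function [quot_lim 0]. *)
Lemma measurable_area e : 0 <= e -> measurable_fun [set: R] (area e).
Proof.
move=> e0; have mc : measurable_fun [set: R] (clamp 0 1).
  apply: nondecreasing_measurable => // s t st.
  by have /andP[] := clamp_homo 0 1 _ _ st.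
have bY := bounded_measurable_Y.
have bX := bounded_measurable_X.
have bT : bounded_measurable (fun s => trapezoid s (s + e)).
  apply: bounded_measurableM.
    apply: bounded_measurableM; last exact: bounded_measurable_cst.
    exact: (bounded_measurableD _ _ bY (bounded_measurable_shift _ e bY)).
  exact: (bounded_measurableB _ _ (bounded_measurable_shift _ e bX) bX).
rewrite (_ : area e = (fun s => quot_lim 0 (clamp 0 1 (s + e))
   - quot_lim 0 (clamp 0 1 s) - trapezoid s (s + e))).
  have mq : measurable_fun [set: R] (fun s => quot_lim 0 (clamp 0 1 s)).
    by apply: measurableT_comp => //; exact: measurable_quot_lim.
  apply: measurable_funB; last by case: bT.
  apply: measurable_funB; last exact: mq.
  by apply: (measurableT_comp mq); exact: measurable_funD.
apply/funext => s; rewrite /area; congr (_ - _).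
have /andP[c1 _] := clamp_itv 0 1 s ler01.
rewrite (quot_lim_split 0 (clamp 0 1 s))//; first by rewrite addrAC subrr add0r.
have se : s <= s + e by lra.
by have /andP[] := clamp_homo 0 1 _ _ se.
Qed.

Lemma area_integrable (g : R -> R) a b e : bounded_measurable g ->
  0 <= a -> b <= 1 -> 0 < e ->
  mu.-integrable `[a, b] (EFin \o (fun s => g s * area e s)).
Proof.
move=> [mg [G gG]] a0 b1 e0; apply: measurable_bounded_integrable => //.
- rewrite /= lebesgue_measure_itv/=.
  by case: ifPn => // _; rewrite -EFinB ltry.
- apply: measurable_funTS; apply: measurable_funM => //.
  exact: (measurable_area e (ltW e0)).
exists (G * (C * (om e ^+ 3 + 2 * V * om e))); split; rewrite ?num_real //.
move=> B ltB s /=; rewrite in_itv/= => /andP[as_ sb].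
apply: le_trans (ltW ltB); rewrite normrM ler_pM//.
have s01 : 0 <= s <= 1 by lra.
apply: le_trans (area_bound _ _ e0 s01) _; rewrite ler_wpM2l// lerD2l.
rewrite ler_wpM2r ?(ct_om0 ct)// ler_wpM2l//.
by have := ct_WV ct (s + 2 * e); have := ct_W0 ct s; lra.
Qed.

(** Pointwise, [area_bound] only gives [O(om e)] near a jump of [W]. Integration in [s] gains the
    missing factor [e] on the [W] term, and the cubic term is [o(e)]. *)
Lemma area_cvg0 (g : R -> R) a b : bounded_measurable g ->
  0 <= a -> a <= b -> b <= 1 ->
  e^-1 * \int[mu]_(s in `[a, b]) (g s * area e s) @[e --> 0^'+] --> 0.
Proof.
move=> bg a0 ab b1; have [_ [G gG]] := bg.
have G0 : 0 <= G by exact: le_trans (gG 0).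
have V0 : 0 <= V by apply: le_trans (ct_W0 ct 0) (ct_WV ct 0).
(* In [4 * V] one factor 2 comes from [area_bound], the other from increments of [W] over the length
   [2 * e]. *)
have bound : G * C * (om e ^+ 3 / e * (b - a) + 4 * V * om e) @[e --> 0^'+] --> 0.
  rewrite -[X in _ --> X](mulr0 (G * C)).
  by apply: cvgMr; exact: ct_error_cvg.
apply/cvgr0Pnorm_le => eta eta0; near=> e.
have e0 : 0 < e by near: e; exact: nbhs_right_gt.
have be : G * C * (om e ^+ 3 / e * (b - a) + 4 * V * om e) <= eta.
  by near: e; exact: (cvgr_le 0).
apply: le_trans be.
rewrite normrM gtr0_norm ?invr_gt0// mulrC ler_pdivrMr//.
have bW := bounded_measurable_W.
have bWW : bounded_measurable (fun s => W (s + 2 * e) - W s).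
  by apply: bounded_measurableB => //; exact: bounded_measurable_shift.
have bc c : bounded_measurable (fun=> c) := bounded_measurable_cst c.
have o1 := ct_om0 ct e.
have e20 : 0 <= 2 * e by lra.
pose F s := om e ^+ 3 + (2 * om e) * (W (s + 2 * e) - W s).
have bF : bounded_measurable F.
  by apply: bounded_measurableD => //; exact: bounded_measurableM.
apply: (@le_trans _ _ (\int[mu]_(s in `[a, b]) ((G * C) * F s))).
  apply: le_trans.
    by apply: le_normr_Rintegral => //; exact: area_integrable.
  apply: le_Rintegral => //.
  - by apply: integrable_norm; exact: area_integrable.
  - by apply: bounded_measurable_integrable; exact: bounded_measurableM.
  - move=> s; rewrite /= in_itv/= => /andP[as_ sb].
    rewrite normrM -mulrA ler_pM//.
    have s01 : 0 <= s <= 1 by lra.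
    by apply: le_trans (area_bound _ _ e0 s01) _; rewrite /F ler_wpM2l//; lra.
rewrite Rintegral_itvZ// -[leRHS]mulrA ler_wpM2l ?mulr_ge0//.
rewrite Rintegral_itv_add//; last exact: bounded_measurableM.
rewrite Rintegral_itv_cst// Rintegral_itvZ//.
have -> : (om e ^+ 3 / e * (b - a) + 4 * V * om e) * e =
    om e ^+ 3 * (b - a) + 2 * om e * (2 * e * V).
  by field; rewrite gt_eqF.
rewrite lerD2l ler_wpM2l ?mulr_ge0//.
apply: le_trans (Rintegral_increment_le _ _ _ _ bW control_W_homo ab e20) _.
rewrite ler_wpM2l//.
by have := ct_WV ct (b + 2 * e); have := ct_W0 ct a; lra.
Unshelve. all: by end_near. Qed.

End Integrand.
End TrapezoidApproximation.

Arguments ct_mX {R X L W om M V}.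
Arguments ct_mL {R X L W om M V}.
Arguments ct_XM {R X L W om M V}.
Arguments ct_LM {R X L W om M V}.
Arguments ct_W0 {R X L W om M V}.
Arguments ct_WV {R X L W om M V}.
Arguments ct_LW {R X L W om M V}.
Arguments ct_X {R X L W om M V}.
Arguments ct_om0 {R X L W om M V}.
Arguments ct_om {R X L W om M V}.
Arguments ct_om_cvg {R X L W om M V}.
Arguments ct_om3_cvg {R X L W om M V}.

(** * Hoelder paths and functions of bounded variation *)

Section ControlOfData.
Context {R : realType}.
Variables (alpha : R) (x l : R -> R).
Hypotheses (alpha_gt : 1 / 3 < alpha) (hx : holder01 alpha x)
  (hl : bounded_variation 0 1 l).

Let cl := clamp (0 : R) 1.

Let cl01 u : 0 <= cl u <= 1. Proof. exact: clamp_itv. Qed.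

Let cl_homo s t : s <= t -> cl s <= cl t.
Proof. by move=> st; have /andP[] := clamp_homo 0 1 _ _ st. Qed.

Let W u := fine (total_variation 0 (cl u) l).

Lemma total_variation_clamp_fin u : total_variation 0 (cl u) l \is a fin_num.
Proof.
have /andP[u0 u1] := cl01 u.
exact/(bounded_variationP _ u0)/(bounded_variationl u0 u1 hl).
Qed.

(** Additivity of the total variation; the subtraction is legitimate because all values are
    finite. *)
Lemma increment_le_total_variation s t : s <= t ->
  `|l (cl t) - l (cl s)| <= W t - W s.
Proof.
move=> st; have cst := cl_homo _ _ st.
have /andP[s0 _] := cl01 s.
have := total_variation_ge l cst.
rewrite -lee_fin EFinB !fineK ?total_variation_clamp_fin//.
rewrite (total_variationD l s0 cst) addeAC subee ?total_variation_clamp_fin//.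
by rewrite add0e.
Qed.

Lemma control_of_data : exists W om (M V : R),
  0 <= M /\ control (x \o cl) (l \o cl) W om M V.
Proof.
have [Lam Lam0 hLam] := hx.
have alpha0 : 0 < alpha by apply: lt_trans alpha_gt; rewrite divr_gt0.
pose om d := Lam * d `^ alpha.
have W_homo s t : s <= t -> W s <= W t.
  move=> /increment_le_total_variation.
  by have := normr_ge0 (l (cl t) - l (cl s)); lra.
have W0 u : 0 <= W u.
  by have /andP[u0 _] := cl01 u; rewrite fine_ge0// total_variation_ge0.
have cl1 u : 1 <= u -> cl u = 1 by move=> u1; rewrite /cl /clamp min_r// max_r.
have cl0 u : u <= 0 -> cl u = 0.
  by move=> u0; rewrite /cl /clamp min_l ?(le_trans u0)//; exact: max_l.
have WV u : W u <= W 1.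
  have [u1|/ltW u1] := leP u 1; first exact: W_homo.
  by rewrite /W (cl1 u)// (cl1 1).
have W00 : W 0 = 0 by rewrite /W cl0// total_variationxx.
have omX s t : s <= t -> `|x (cl t) - x (cl s)| <= om (t - s).
  move=> st; apply: le_trans (hLam _ _ (cl01 s) (cl01 t)) _.
  rewrite /om (ler_wpM2l (ltW Lam0))//.
  apply: (ge0_ler_powR (ltW alpha0)); rewrite ?nnegrE// ?subr_ge0//.
  apply: le_trans (clamp_lipschitz _ _ _ _) _.
  by rewrite ger0_norm// subr_ge0.
have om_mono d d' : 0 <= d -> d <= d' -> om d <= om d'.
  move=> d0 dd; rewrite /om (ler_wpM2l (ltW Lam0))//.
  by apply: (ge0_ler_powR (ltW alpha0)); rewrite ?nnegrE ?(le_trans d0).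
have om_cvg : om e @[e --> 0^'+] --> 0.
  rewrite -[X in _ --> X](mulr0 Lam).
  by apply: cvgMr; exact: powR_cvg0.
have om3_cvg : om e ^+ 3 / e @[e --> 0^'+] --> 0.
  have a3 : 0 < 3 * alpha - 1.
    by move: alpha_gt; rewrite ltr_pdivrMr// => ?; lra.
  have : Lam ^+ 3 * e `^ (3 * alpha - 1) @[e --> 0^'+] --> 0.
    rewrite -[X in _ --> X](mulr0 (Lam ^+ 3)).
    by apply: cvgMr; exact: powR_cvg0.
  apply: cvg_trans; apply: near_eq_cvg; near=> e.
  have e0 : 0 < e by near: e; exact: nbhs_right_gt.
  rewrite (@powRD _ e (3 * alpha) (-1)) ?(gt_eqF e0) ?implybT//.
  by rewrite powR_inv1 ?ltW// (mulrC 3) powRrM powR_mulrn ?powR_ge0// /om exprMn; ring.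
have mX : measurable_fun [set: R] (x \o cl).
  apply: continuous_measurable_fun => t; apply/cvgrPdist_le => eps eps0.
  have [delta delta0 omdelta] := near_right0_ex _ (cvgr_le 0 om_cvg _ eps0).
  near=> s.
  have st : `|t - s| < delta.
    by near: s; apply: cvgr_dist_lt; [exact: cvg_id|].
  have [->|ts] := eqVneq t s; first by rewrite subrr normr0 ltW.
  apply: (@le_trans _ _ (om `|t - s|)).
    case/orP: (le_total t s) => h.
      rewrite distrC (distrC t) [`|s - t|]ger0_norm ?subr_ge0//; exact: omX.
    rewrite [`|t - s|]ger0_norm ?subr_ge0//; exact: omX.
  by apply: omdelta; rewrite normr_gt0 subr_eq0 ts.
have mL : measurable_fun [set: R] (l \o cl).
  (* Jordan decomposition into a difference of nondecreasing functions. *)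
  rewrite (_ : l \o cl = fun u => W u - (W u - l (cl u))); last first.
    by apply/funext => u /=; ring.
  apply: measurable_funB; apply: nondecreasing_measurable => // s t st.
  have := increment_le_total_variation _ _ st; rewrite ler_norml; lra.
(* One bound for both paths: from time 0, [x] moves by at most [om 1] and [l] by at most [W 1]. *)
pose M := `|x (cl 0)| + om 1 + (`|l (cl 0)| + W 1).
have om1 : 0 <= om 1 by rewrite mulr_ge0 ?powR_ge0 ?ltW.
have W1 := W0 1.
have XM u : `|x (cl u)| <= `|x (cl 0)| + om 1.
  have -> : x (cl u) = x (cl 0) + (x (cl u) - x (cl 0)) by ring.
  apply: le_trans (ler_normD _ _) _; rewrite lerD2l.
  have [u0 u1] : 0 <= cl u /\ cl u <= 1 by have /andP[] := cl01 u.
  have := omX _ _ u0; rewrite (_ : cl (cl u) = cl u); last exact: clamp_id.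
  move=> /le_trans; apply; apply: om_mono; lra.
have LM u : `|l (cl u)| <= `|l (cl 0)| + W 1.
  have -> : l (cl u) = l (cl 0) + (l (cl u) - l (cl 0)) by ring.
  apply: le_trans (ler_normD _ _) _; rewrite lerD2l.
  have [u0 u1] : 0 <= cl u /\ cl u <= 1 by have /andP[] := cl01 u.
  have := increment_le_total_variation _ _ u0.
  rewrite (_ : cl (cl u) = cl u); last exact: clamp_id.
  by have := WV (cl u); lra.
have n1 := normr_ge0 (x (cl 0)); have n2 := normr_ge0 (l (cl 0)).
exists W, om, M, (W 1); split; first by rewrite /M; lra.
split=> //.
- by move=> u; apply: le_trans (XM u) _; rewrite /M; lra.
- by move=> u; apply: le_trans (LM u) _; rewrite /M; lra.
- exact: increment_le_total_variation.
- by move=> d; rewrite mulr_ge0 ?powR_ge0 ?ltW.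
Unshelve. all: by end_near. Qed.

End ControlOfData.

(** * Symmetric integrals through the extended paths *)

Section SymmetricIntegral.
Context {R : realType}.
Local Notation mu := (@lebesgue_measure R).
Variables (x l W om : R -> R) (M V : R).
Let cl := clamp (0 : R) 1.
Let X := x \o cl.
Let L := l \o cl.
Hypothesis (ct : control X L W om M V).

(** The lower cut-off of [clamp] acts on negative times only. *)
Lemma stopped1_clamp (z : R -> R) u : 0 <= u -> stopped1 z u = z (clamp 0 1 u).
Proof.
move=> u0; rewrite /stopped1 /clamp; congr z; apply/esym/max_r.
by rewrite le_min u0 ler01.
Qed.

Section Symmetric.
Variable h : R * R -> R.
Hypotheses (M0 : 0 <= M) (hC21 : class_C21 h).
Let y t := h (x t, l t).

Lemma measurable_class_C21 : measurable_fun [set: R] (fun u => h (X u, L u)).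
Proof.
case: hC21 => _ [ch _ _ _].
by apply: measurable_continuous_pair => //; [exact: (ct_mX ct)|exact: (ct_mL ct)].
Qed.

Lemma sym_integrandE e u : 0 <= u -> 0 <= e ->
  sym_integrand y x e u = quot_integrand X L h e u.
Proof.
by move=> u0 e0; rewrite /sym_integrand !stopped1_clamp// addr_ge0.
Qed.

Lemma sym_approxE r s e : 0 <= r -> 0 <= e ->
  sym_approx y x r s e = quot_mean X L h r s e.
Proof.
move=> r0 e0; congr (_ * _); apply: eq_Rintegral => u.
rewrite inE/= in_itv/= => /andP[ru _].
by rewrite sym_integrandE// (le_trans r0).
Qed.

Lemma sym_integrand_integrable r s e : 0 <= r -> 0 <= e ->
  mu.-integrable `[r, s] (EFin \o sym_integrand y x e).
Proof.
move=> r0 e0; have [C [H [C0 hH]]] := C21_primitive h M M0 hC21.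
have bQ := bounded_measurable_quot _ _ _ _ _ _ ct _ _ _ hH measurable_class_C21 e.
apply: eq_integrable (bounded_measurable_integrable _ r s bQ) => //.
move=> u; rewrite inE/= in_itv/= => /andP[ru _] /=.
by rewrite sym_integrandE// (le_trans r0).
Qed.

Lemma sym_approx_cvg r s : 0 <= r ->
  sym_approx y x r s e @[e --> 0^'+] --> quot_lim X L h r s.
Proof.
move=> r0; have [C [H [C0 hH]]] := C21_primitive h M M0 hC21.
have c := quot_mean_cvg _ _ _ _ _ _ ct _ _ _ C0 hH measurable_class_C21 r s.
apply: cvg_trans c; apply: near_eq_cvg; near=> e.
by rewrite sym_approxE//; near: e; exact: nbhs_right_ge.
Unshelve. all: by end_near. Qed.

Lemma sym_exists_C21 r s : 0 <= r -> sym_exists y x r s.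
Proof.
move=> r0; split.
  near=> e; have e0 : 0 <= e by near: e; exact: nbhs_right_ge.
  exact: sym_integrand_integrable.
by apply/cvg_ex; exists (quot_lim X L h r s); exact: sym_approx_cvg.
Unshelve. all: by end_near. Qed.

Lemma sym_integralE r s : 0 <= r -> r <= s ->
  sym_integral y x r s = quot_lim X L h r s.
Proof.
by move=> r0 rs; rewrite /sym_integral rs; apply: cvg_lim => //; exact: sym_approx_cvg.
Qed.

(** For [e >= 0] the clamped times are in order, so [sym_integral] is taken in its branch
    [r <= s]. *)
Lemma levy_areaE s e : 0 <= s <= 1 -> 0 <= e ->
  levy_area y x (Num.min s 1) (Num.min (s + e) 1) = area X L h e s.
Proof.
move=> /andP[s0 s1] e0.
have cE u : 0 <= u -> Num.min u 1 = cl u by move=> /(stopped1_clamp id).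
rewrite !cE ?addr_ge0//.
have clcl u : cl (cl u) = cl u by apply: clamp_id; exact: clamp_itv.
have /andP[c0 _] := clamp_itv 0 1 s ler01.
have se : s <= s + e by rewrite lerDl.
have /andP[cs _] := clamp_homo 0 1 _ _ se.
by rewrite /levy_area sym_integralE.
Qed.

End Symmetric.

Lemma corr_integrandE (h : R * R -> R) (f : R -> R) e s :
  0 <= M -> class_C21 h -> 0 <= s <= 1 -> 0 <= e ->
  corr_integrand f (fun t => h (x t, l t)) (levy_area (fun t => h (x t, l t)) x) e s
  = derive1 f (h (X s, L s)) * area X L h e s.
Proof.
move=> M0 hC21 s01 e0; rewrite /corr_integrand levy_areaE// stopped1_clamp//.
by case/andP: s01.
Qed.

Lemma bounded_measurable_derive1 (h : R * R -> R) (f : R -> R) :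
  0 <= M -> class_C21 h -> class_C2 f ->
  bounded_measurable (fun s => derive1 f (h (X s, L s))).
Proof.
move=> M0 hC21 [_ df _]; have cf := derivable1_continuous _ df.
have mh := measurable_class_C21 h hC21.
have [C [H [C0 hH]]] := C21_primitive h M M0 hC21.
split.
  by apply: (measurableT_comp _ mh); exact: continuous_measurable_fun.
(* [f'] is viewed as a function of a pair to reuse the bound on squares; the values of [h] along the
   path lie in [[-C, C]]. *)
have cf1 : continuous (fun p : R * R => derive1 f p.1).
  by move=> p; apply: continuous_comp; [exact: cvg_fst|exact: cf].
have [B B0 fB] := continuous_bounded_box _ C cf1.
exists B => u; apply: (fB _ 0); last by rewrite normr0.
by apply: (tp_bound hH); [exact: (ct_XM ct)|exact: (ct_LM ct)].
Qed.

End SymmetricIntegral.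

(** * Equality of the corrected and the uncorrected integral *)

Theorem proposition3p5 (R : realType) (alpha : R) (x : R -> R)
    (h : R * R -> R) (l : R -> R) :
  1 / 3 < alpha -> alpha < 1 ->
  holder01 alpha x ->
  class_C21 h ->
  bounded_variation 0 1 l ->
  let y := fun t : R => h (x t, l t) in
  let A := levy_area y x in
  (forall r s : R, 0 <= r -> r <= s -> s <= 1 -> sym_exists y x r s) /\
  (forall f : R -> R, class_C2 f ->
   forall a b : R, 0 <= a -> a <= b -> b <= 1 ->
     [/\ corr_exists f y x A a b,
         sym_exists (f \o y) x a b &
         corr_integral f y x A a b = sym_integral (f \o y) x a b]).
Proof.
move=> a13 _ hx hC21 hl y A.
have [W [om [M [V [M0 ct]]]]] := control_of_data alpha x l a13 hx hl.
split=> [r s r0 _ _|f fC2 a b a0 ab b1]; first exact: (sym_exists_C21 _ _ _ _ _ _ ct).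
have fh := class_C21_comp f h fC2 hC21.
have [C [H [C0 hH]]] := C21_primitive h M M0 hC21.
have mh := measurable_class_C21 _ _ _ _ _ _ ct h hC21.
have clcl u : clamp 0 1 (clamp 0 1 u) = clamp 0 1 u :> R.
  by apply: clamp_id; exact: clamp_itv.
have Xcl u : (x \o clamp 0 1) (clamp 0 1 u) = (x \o clamp 0 1) u by rewrite /= clcl.
have Lcl u : (l \o clamp 0 1) (clamp 0 1 u) = (l \o clamp 0 1) u by rewrite /= clcl.
set X := x \o clamp 0 1 in ct mh Xcl; set L := l \o clamp 0 1 in ct mh Lcl.
(* On [[a, b]] this is [f'(y_s)]; the extended paths make it bounded and measurable on the whole
   line. *)
pose g s := derive1 f (h (X s, L s)).
have bg : bounded_measurable g.
  exact: (bounded_measurable_derive1 _ _ _ _ _ _ ct).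
have corrE e s : 0 <= e -> a <= s <= b -> corr_integrand f y A e s = g s * area X L h e s.
  move=> e0 sab; apply: (corr_integrandE _ _ _ _ _ _ ct) => //; lra.
(* The means of [f \o y] converge because [f \o h] has the regularity of [h]; the correction,
   weighted by [g], tends to 0, so both integrals have the limit [quot_lim X L (f \o h) a b]. *)
have c1 := sym_approx_cvg _ _ _ _ _ _ ct (f \o h) M0 fh a b a0.
have c2 := area_cvg0 _ _ _ _ _ _ ct h H C C0 hH mh Xcl Lcl g a b bg a0 ab b1.
have c : corr_approx f y x A a b e @[e --> 0^'+] --> quot_lim X L (f \o h) a b.
  have c3 : sym_approx (f \o y) x a b e
      + e^-1 * \int[lebesgue_measure]_(s in `[a, b]) (g s * area X L h e s)
      @[e --> 0^'+] --> quot_lim X L (f \o h) a b.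
    by rewrite -[X in _ --> X]addr0; exact: cvgD c1 c2.
  apply: cvg_trans c3.
  apply: near_eq_cvg; near=> e.
  have e0 : 0 <= e by near: e; exact: nbhs_right_ge.
  congr (_ + _ * _); apply: eq_Rintegral => s.
  by rewrite inE/= in_itv/= => sab; rewrite corrE.
have se : sym_exists (f \o y) x a b.
  exact: (sym_exists_C21 _ _ _ _ _ _ ct (f \o h)).
split=> //.
- split; last by apply/cvg_ex; exists (quot_lim X L (f \o h) a b).
  near=> e.
  have e0 : 0 < e by near: e; exact: nbhs_right_gt.
  split.
    exact: (sym_integrand_integrable _ _ _ _ _ _ ct (f \o h) M0 fh a b e a0 (ltW e0)).
  apply: eq_integrable (area_integrable _ _ _ _ _ _ ct h H C C0 hH mh Xcl Lcl
    g a b e bg a0 b1 e0) => // s.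
  by rewrite inE/= in_itv/= => sab /=; rewrite corrE// ltW.
- rewrite /corr_integral (cvg_lim _ c)//; apply/esym.
  exact: (sym_integralE _ _ _ _ _ _ ct (f \o h)).
Unshelve. all: by end_near. Qed.
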